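(* Let $n\ge2$ and let $A$ be a real symmetric $n\times n$ matrix all of whose diagonal entries are equal to the same number $q$. Define $$\widetilde{\lambda}(A)=\sup_{x\ge0}\ \min_{i\ne j}\left(q-x-\tfrac12\bigl(R_i(A-x\mathbf 1)+R_j(A-x\mathbf 1)\bigr)\right).$$ Then every eigenvalue of $A$ is greater than or equal to $\widetilde{\lambda}(A)$.
   Context: $\mathbf 1$ denotes the $n\times n$ matrix with all entries equal to $1$. For an $n\times n$ matrix $B=(b_{ij})$, $R_i(B)=\sum_{j\ne i}|b_{ij}|$. *)

(* Defs.v *)
From HB Require Import structures.
From mathcomp Require Import all_boot all_order all_algebra.
From mathcomp Require Import boolp classical_sets reals.

Set Implicit Arguments.
Unset Strict Implicit.
Unset Printing Implicit Defensive.

Import Order.TTheory GRing.Theory Num.Theory.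

Local Open Scope classical_set_scope.
Local Open Scope ring_scope.

Definition ones_mx {R : realType} (n : nat) : 'M[R]_n := const_mx 1.

Definition deleted_row_sum {R : realType} (n : nat) (B : 'M[R]_n) (i : 'I_n) : R :=
  \sum_(j < n | j != i) `|B i j|.

Definition pair_bound {R : realType} (n : nat) (q : R) (A : 'M[R]_n) (x : R)
    (i j : 'I_n) : R :=
  q - x - 2^-1 * (deleted_row_sum (A - x *: ones_mx n) i
                  + deleted_row_sum (A - x *: ones_mx n) j).

(* The minimum over pairs i != j is written as the infimum of a finite set of
   reals; [min_pair_bound_is_min] shows that it is a minimum when n >= 2. *)
Definition min_pair_bound {R : realType} (n : nat) (q : R) (A : 'M[R]_n) (x : R) : R :=
  inf [set pair_bound q A x p.1 p.2 | p in [set p : 'I_n * 'I_n | p.1 != p.2]].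

Definition lambda_tilde {R : realType} (n : nat) (q : R) (A : 'M[R]_n) : R :=
  sup [set min_pair_bound q A x | x in [set x : R | 0 <= x]].

Lemma min_pair_bound_is_min (R : realType) (n : nat) (q : R) (A : 'M[R]_n) (x : R) :
  (1 < n)%N ->
  (exists i j : 'I_n, i != j /\ min_pair_bound q A x = pair_bound q A x i j) /\
  (forall i j : 'I_n, i != j -> min_pair_bound q A x <= pair_bound q A x i j).
Proof.
move=> n1; pose F (p : 'I_n * 'I_n) := pair_bound q A x p.1 p.2.
pose p0 : 'I_n * 'I_n := (Ordinal (ltnW n1), Ordinal n1).
have p0P : p0.1 != p0.2 by [].
case: (Order.TotalTheory.arg_minP F (P := fun p => p.1 != p.2) p0P) => m mP mmin.
have -> : min_pair_bound q A x = F m.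
  apply/eqP; rewrite eq_le; apply/andP; split.
    apply: ge_inf; last by exists m.
    by exists (F m) => _ [p pP <-]; exact: mmin.
  apply: lb_le_inf; first by exists (F m), m.
  by move=> _ [p pP <-]; exact: mmin.
split; first by exists m.1, m.2.
by move=> i j ij; exact: (mmin (i, j)).
Qed.

(* The supremum defining [lambda_tilde] is finite, so [sup] takes no default value. *)
Lemma lambda_tilde_has_sup (R : realType) (n : nat) (q : R) (A : 'M[R]_n) :
  (1 < n)%N -> has_sup [set min_pair_bound q A x | x in [set x : R | 0 <= x]].
Proof.
move=> n1; split; first by exists (min_pair_bound q A 0), 0 => /=.
exists q => _ [x /= x0 <-].
have [[i [j [_ ->]]] _] := min_pair_bound_is_min q A x n1.
rewrite /pair_bound -addrA gerDl -opprD oppr_le0 addr_ge0 // mulr_ge0 ?invr_ge0 //.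
by rewrite addr_ge0 // sumr_ge0.
Qed.

(* Main.v *)
Require Import Defs.
From HB Require Import structures.
From mathcomp Require Import all_boot all_order all_algebra.
From mathcomp Require Import boolp classical_sets reals.
From mathcomp Require Import ring lra.

(** Why the bound holds.  Fix [x >= 0] and put [B = A - x 1], a symmetric matrix
    with constant diagonal [q - x].  The all-ones matrix is positive
    semidefinite, so the quadratic form of [A] dominates that of [B].  At an
    eigenvector [v] for [a] the form of [A] is [a |v|^2], so it suffices to bound
    the form of [B] from below by [m |v|^2], where [m] is the minimum over the
    pairs.  Nothing has to be diagonalized.

    Write [M = q - x - m], so that [R_i + R_j <= 2 M] whenever [i != j].  The
    off-diagonal part of the form is at least [- M |v|^2] as soon as there is a
    positive weight [w] with [\sum_(j != i) |B i j| w_j <= M w_i] for every [i]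
    (the Schur test, [schur_test]).  Such a weight exists
    ([schur_weight_of_pair_sums]): if every [R_i <= M] the constant weight does
    it; otherwise exactly one row [k] has [R_k > M], every other row has
    [R_j <= 2 M - R_k], and one raises the weight of [k] alone to [R_k / M].
    Row [k] is then tight, and on the other rows the required inequality follows
    from [R_k (2 M - R_k) <= M^2], which is the arithmetic-geometric mean
    inequality behind Brauer's ovals of Cassini. *)

Set Implicit Arguments.
Unset Strict Implicit.
Unset Printing Implicit Defensive.

Import Order.TTheory GRing.Theory Num.Theory.

Local Open Scope ring_scope.

(** Weighted AM-GM on each pair: [2 |v_i v_j| <= (w_j/w_i) v_i^2 + (w_i/w_j) v_j^2].
    By symmetry both terms contribute the same total once summed, and the
    hypothesis on [w] says that the coefficient of [v_i^2] is at most [M]. *)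
Lemma schur_test (R : realFieldType) (n : nat) (B : 'M[R]_n) (M : R)
    (w v : 'I_n -> R) :
  B^T = B -> (forall i, 0 < w i) ->
  (forall i, \sum_(j < n | j != i) `|B i j| * w j <= M * w i) ->
  - (M * \sum_i v i ^+ 2) <= \sum_i \sum_(j < n | j != i) B i j * v i * v j.
Proof.
move=> symB w_gt0 rowB.
have Bsym i j : B i j = B j i by rewrite -[in LHS]symB mxE.
pose T i j := `|B i j| * (w j / w i * v i ^+ 2).
have pairB i j : - (T i j + T j i) <= 2 * (B i j * v i * v j).
  rewrite /T (Bsym j i) -mulrDr.
  set S := _ + _.
  have sq s : s ^+ 2 = 1 -> 0 <= S + 2 * s * (v i * v j).
    move=> s2; have wi := w_gt0 i; have wj := w_gt0 j.
    have -> : S + 2 * s * (v i * v j) =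
        (w j * v i + s * (w i * v j)) ^+ 2 / (w i * w j).
      rewrite sqrrD [(s * _) ^+ 2]exprMn s2 /S.
      by field; rewrite !gt_eqF.
    by rewrite divr_ge0 ?sqr_ge0 // mulr_ge0 ?ltW.
  have Sp := sq 1 (expr1n _ _).
  have Sm := sq (-1) (etrans (sqrrN _) (expr1n _ _)).
  have [b0|b0] := ger0P (B i j); nra.
have sumT : \sum_i \sum_(j < n | j != i) T i j <= M * \sum_i v i ^+ 2.
  rewrite mulr_sumr; apply: ler_sum => i _.
  have -> : \sum_(j < n | j != i) T i j =
      (\sum_(j < n | j != i) `|B i j| * w j) * (v i ^+ 2 / w i).
    rewrite mulr_suml; apply: eq_bigr => j _; rewrite /T; ring.
  have -> : M * v i ^+ 2 = M * w i * (v i ^+ 2 / w i).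
    by field; rewrite gt_eqF.
  by rewrite ler_wpM2r // divr_ge0 ?sqr_ge0 ?ltW.
have swapT : \sum_i \sum_(j < n | j != i) T j i = \sum_i \sum_(j < n | j != i) T i j.
  rewrite (exchange_big_dep xpredT) //=.
  by apply: eq_bigr => j _; apply: eq_bigl => i; rewrite eq_sym.
have : - (\sum_i \sum_(j < n | j != i) T i j + \sum_i \sum_(j < n | j != i) T j i)
    <= 2 * \sum_i \sum_(j < n | j != i) B i j * v i * v j.
  rewrite -big_split -sumrN mulr_sumr; apply: ler_sum => i _.
  by rewrite -big_split -sumrN mulr_sumr; apply: ler_sum => j _; exact: pairB.
rewrite swapT => ?; lra.
Qed.

(** Only one row sum can exceed half of the bound on pairs, and the excess is
    absorbed by the weight of that row.  At least two rows are required: the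
    hypothesis says nothing about a single one. *)
Lemma schur_weight_of_pair_sums (R : realType) (n : nat) (B : 'M[R]_n) (M : R) :
  (2 <= n)%N ->
  (forall i j : 'I_n, i != j -> deleted_row_sum B i + deleted_row_sum B j <= 2 * M) ->
  exists w : 'I_n -> R, (forall i, 0 < w i) /\
    (forall i, \sum_(j < n | j != i) `|B i j| * w j <= M * w i).
Proof.
move=> n_ge2 pairM; pose r := deleted_row_sum B.
have r_ge0 i : 0 <= r i by apply: sumr_ge0.
have [/forallP rM|/forallPn[k]] := boolP [forall i, r i <= M].
  exists (fun=> 1); split=> [i|i]; first exact: ltr01.
  by rewrite mulr1 -mulr_suml mulr1; exact: rM.
rewrite -ltNge => Mrk.
have [l lk] : exists l : 'I_n, l != k.
  have [k0|] := eqVneq (Ordinal (ltnW n_ge2)) k; last by exists (Ordinal (ltnW n_ge2)).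
  by exists (Ordinal n_ge2); rewrite -k0.
have M_gt0 : 0 < M.
  have := pairM l k lk; have := r_ge0 l; rewrite -/(r l) -/(r k) => ? ?; lra.
pose s := r k / M.
have s_ge1 : 1 <= s by rewrite ler_pdivlMr // mul1r ltW.
exists (fun i => if i == k then s else 1); split=> [i|i].
  by case: ifP => _ //; exact: lt_le_trans s_ge1.
have [->|ik] := eqVneq i k.
  rewrite mulrCA divff ?gt_eqF // mulr1.
  by apply: ler_sum => j /negPf ->; rewrite mulr1.
(* On a row other than [k] every weight is at most [s]. *)
apply: (@le_trans _ _ (r i * s)).
  rewrite mulr_suml; apply: ler_sum => j _; apply: ler_wpM2l => //.
  by case: ifP.
rewrite mulr1 mulrA ler_pdivrMr //.
(* [r i * r k <= (2 M - r k) * r k = M^2 - (r k - M)^2]. *)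
have := pairM i k ik; rewrite -/(r i) -/(r k) => ?.
have := r_ge0 i; have := sqr_ge0 (r k - M); nra.
Qed.

(** The shift by [x] only helps, since the all-ones form is [(\sum_i v_i)^2]. *)
Lemma quadratic_form_ge_min_pair_bound (R : realType) (n : nat) (A : 'M[R]_n)
    (q x : R) (v : 'I_n -> R) :
  (2 <= n)%N -> A^T = A -> (forall i, A i i = q) -> 0 <= x ->
  min_pair_bound q A x * (\sum_i v i ^+ 2) <= \sum_i \sum_j A i j * v i * v j.
Proof.
move=> n_ge2 symA diagA x_ge0.
have [_ minP] := min_pair_bound_is_min q A x n_ge2.
set m := min_pair_bound q A x in minP *.
pose B := A - x *: ones_mx n.
have BE i j : B i j = A i j - x by rewrite !mxE mulr1.
have symB : B^T = B.
  by apply/matrixP => i j; rewrite mxE !BE -[in LHS]symA mxE.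
have pairM i j : i != j ->
    deleted_row_sum B i + deleted_row_sum B j <= 2 * (q - x - m).
  by move=> /minP; rewrite /pair_bound -/B => ?; lra.
have [w [w_gt0 rowB]] := schur_weight_of_pair_sums n_ge2 pairM.
have := schur_test v symB w_gt0 rowB.
have -> : \sum_i \sum_j A i j * v i * v j =
    (q - x) * (\sum_i v i ^+ 2) + \sum_i \sum_(j < n | j != i) B i j * v i * v j
    + x * (\sum_i v i) ^+ 2.
  rewrite expr2 mulr_suml !mulr_sumr -!big_split; apply: eq_bigr => i _ /=.
  rewrite mulr_sumr mulr_sumr.
  have -> : (q - x) * v i ^+ 2 + \sum_(j < n | j != i) B i j * v i * v j =
      \sum_j B i j * v i * v j.
    by rewrite [RHS](bigD1 i) //= BE diagA expr2 mulrA.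
  by rewrite -big_split; apply: eq_bigr => j _ /=; rewrite BE; ring.
have : 0 <= x * (\sum_i v i) ^+ 2 by rewrite mulr_ge0 ?sqr_ge0.
move=> ? ?; nra.
Qed.

Theorem theorem4p2 (R : realType) (n : nat) (hn : (2 <= n)%N) (A : 'M[R]_n) (q : R)
    (hsym : A^T = A) (hdiag : forall i : 'I_n, A i i = q) (a : R)
    (ha : eigenvalue A a) :
  lambda_tilde q A <= a.
Proof.
apply: ge_sup; first exact: (lambda_tilde_has_sup q A hn).1.
move=> _ [x /= x_ge0 <-].
case/eigenvalueP: ha => v vA v_neq0.
have [i0 vi0] : exists i, v 0 i != 0.
  by case/rV0Pn: v_neq0 => i; exists i.
have v2_gt0 : 0 < \sum_i v 0 i ^+ 2.
  rewrite (bigD1 i0) //= ltr_pwDl ?sumr_ge0 // => [|i _]; last exact: sqr_ge0.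
  by rewrite exprn_even_gt0.
rewrite -(ler_pM2r v2_gt0).
apply: le_trans (quadratic_form_ge_min_pair_bound _ hn hsym hdiag x_ge0) _.
(* [v] is a left eigenvector, so the sum over the row index is done first. *)
rewrite exchange_big mulr_sumr /= le_eqVlt; apply/orP; left; apply/eqP.
apply: eq_bigr => j _; rewrite -mulr_suml expr2 mulrA; congr (_ * _).
have /rowP/(_ j) := vA; rewrite !mxE => <-.
by apply: eq_bigr => i _; rewrite mulrC.
Qed.
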